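(* For any formula $\phi$ of $\mathcal L$: (1) if $\vdash_\Re\phi$, then $\{\xi_u\}_{u\in U}\vDash\phi$ for any enumeration $\{\xi_u\}_{u\in U}$ of nondeterministic partial recursive functions; (2) if $\vdash_{\Re_d}\phi$, then $\{\xi_u\}_{u\in U}\vDash\phi$ for any enumeration $\{\xi_u\}_{u\in U}$ of deterministic partial recursive functions.
   Context: The language $\mathcal L$: formulas built from propositional variables and $\bot$ using $\rightarrow$ and a binary modality $\rhd$; $\wedge,\vee,\neg,\top$ defined as usual. The logic $\Re$: classical propositional logic in $\mathcal L$ plus axioms A1: $\phi\rhd\psi\rightarrow(\chi\rhd\psi\rightarrow(\phi\vee\chi)\rhd\psi)$, A2: $\bot\rhd\phi$, A3: $\phi\rhd\top$, with rules Modus Ponens and M: from $\phi_1\rightarrow\phi_2$ and $\psi_1\rightarrow\psi_2$ infer $\phi_2\rhd\psi_1\rightarrow\phi_1\rhd\psi_2$. The logic $\Re_d$ is $\Re$ plus axiom A4: $\phi\rhd\psi\rightarrow(\phi\rhd\chi\rightarrow\phi\rhd(\psi\wedge\chi))$. Semantics: $U$ is a universe (e.g. all words over an alphabet) and $\{\xi_u\}_{u\in U}$ is an enumeration, indexed by elements of $U$, of partial recursive functions from $U$ to $U$; a nondeterministic partial recursive function $\xi_w$ assigns to each argument $x$ the (possibly empty) set $\xi_w(x)\subseteq U$ of all values a nondeterministic machine computing it may return on input $x$; a deterministic one is the special case where each $\xi_w(x)$ has at most one element. A valuation $*$ maps propositional variables to subsets of $U$ and is extended by $\bot^*=\varnothing$,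 $(\phi\rightarrow\psi)^*=(U\setminus\phi^* )\cup\psi^*$, and $(\phi\rhd\psi)^*=\{w\in U\mid \forall u\in\phi^*\ (\xi_w(u)\neq\varnothing\rightarrow \xi_w(u)\cap\psi^*\neq\varnothing)\}$. We write $\{\xi_u\}_{u\in U}\vDash\phi$ if $\phi^*=U$ for every valuation $*$. *)

(* Defs.v *)
From Stdlib Require Import Relation_Operators.
From mathcomp Require Import all_boot.
From mathcomp Require Import classical_sets.

Set Implicit Arguments.
Unset Strict Implicit.
Unset Printing Implicit Defensive.

Local Open Scope classical_set_scope.

Inductive form : Type :=
| Var of nat
| Bot
| Imp of form & form
| Rhd of form & form.

Declare Scope form_scope.
Delimit Scope form_scope with form.
Bind Scope form_scope with form.

Notation "A |> B" := (Rhd A B)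
  (at level 50, no associativity) : form_scope.
Notation "A ==> B" := (Imp A B) : form_scope.

Local Open Scope form_scope.

Definition Neg (A : form) : form := A ==> Bot.
Definition Top : form := Neg Bot.
Definition Or (A B : form) : form := Neg A ==> B.
Definition And (A B : form) : form := Neg (A ==> Neg B).

(* With Modus Ponens, a complete axiomatization of classical propositional
   logic over implication and falsum; the metavariables range over all
   formulas, including those containing [|>]. *)
Inductive CPL_axiom : form -> Prop :=
| CPL_K A B : CPL_axiom (A ==> (B ==> A))
| CPL_S A B C :
    CPL_axiom ((A ==> (B ==> C)) ==> ((A ==> B) ==> (A ==> C)))
| CPL_DN A : CPL_axiom (Neg (Neg A) ==> A).

Inductive Re_axiom : form -> Prop :=
| Re_CPL A : CPL_axiom A -> Re_axiom A
| Re_A1 A B C : Re_axiom (A |> B ==> (C |> B ==> Or A C |> B))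
| Re_A2 A : Re_axiom (Bot |> A)
| Re_A3 A : Re_axiom (A |> Top).

Inductive Red_axiom : form -> Prop :=
| Red_Re A : Re_axiom A -> Red_axiom A
| Red_A4 A B C : Red_axiom (A |> B ==> (A |> C ==> A |> And B C)).

Inductive derivable (Ax : form -> Prop) : form -> Prop :=
| der_ax A : Ax A -> derivable Ax A
| der_MP A B : derivable Ax (A ==> B) -> derivable Ax A -> derivable Ax B
| der_M A1 A2 B1 B2 :
    derivable Ax (A1 ==> A2) -> derivable Ax (B1 ==> B2) ->
    derivable Ax (A2 |> B1 ==> A1 |> B2).

Definition Re_provable : form -> Prop := derivable Re_axiom.
Definition Red_provable : form -> Prop := derivable Red_axiom.

(* Nondeterministic register (Minsky) machines. Every instruction names the
   label(s) where the run continues: [Inc r l] increments register [r];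
   [Dec r l l'] decrements it and goes to [l] if it is positive, and goes to
   [l'] otherwise; [Fork l l'] continues at either label. *)
Inductive instr : Type :=
| Inc of nat & nat
| Dec of nat & nat & nat
| Fork of nat & nat.

Definition machine : Type := seq instr.
Definition config : Type := (nat * (nat -> nat))%type.

Definition set_reg (rho : nat -> nat) (r v : nat) : nat -> nat :=
  fun s => if s == r then v else rho s.

Inductive step (M : machine) : config -> config -> Prop :=
| step_inc pc rho r l :
    onth M pc = Some (Inc r l) ->
    step M (pc, rho) (l, set_reg rho r (rho r).+1)
| step_dec_pos pc rho r l l' :
    onth M pc = Some (Dec r l l') -> 0 < rho r ->
    step M (pc, rho) (l, set_reg rho r (rho r).-1)
| step_dec_zero pc rho r l l' :
    onth M pc = Some (Dec r l l') -> rho r = 0 ->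
    step M (pc, rho) (l', rho)
| step_fork_l pc rho l l' :
    onth M pc = Some (Fork l l') -> step M (pc, rho) (l, rho)
| step_fork_r pc rho l l' :
    onth M pc = Some (Fork l l') -> step M (pc, rho) (l', rho).

(* Input and output are in register 0, all other registers start at 0, the run
   starts at label 0, and it halts when the current label is outside [M]. *)
Definition may_return (M : machine) (n m : nat) : Prop :=
  exists pc rho,
    [/\ clos_refl_trans config (step M)
          (0, set_reg (fun=> 0) 0 n) (pc, rho),
        onth M pc = None & rho 0 = m].

(* The universe is any type with a coding by natural numbers, the one carried
   by its [countType] structure (for instance words over a finite alphabet);
   machines compute on codes. *)
Definition nd_partial_recursive (U : countType) (f : U -> set U) : Prop :=
  exists M : machine, forall x : U,
    [set m | may_return M (pickle x) m] = pickle @` f x.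

Definition partial_recursive (U : countType) (f : U -> set U) : Prop :=
  nd_partial_recursive f /\ forall x : U, is_subset1 (f x).

Fixpoint sem (U : Type) (xi : U -> U -> set U) (v : nat -> set U)
    (A : form) : set U :=
  match A with
  | Var p => v p
  | Bot => set0
  | B ==> C => ~` sem xi v B `|` sem xi v C
  | B |> C =>
      [set w | forall u, sem xi v B u ->
         xi w u !=set0 -> xi w u `&` sem xi v C !=set0]
  end.

Definition valid (U : Type) (xi : U -> U -> set U) (A : form) : Prop :=
  forall v : nat -> set U, sem xi v A = [set: U].

(* Main.v *)
Require Import Defs.
From mathcomp Require Import all_boot.
From mathcomp Require Import classical_sets.
From mathcomp Require Import boolp.

Local Open Scope classical_set_scope.
Local Open Scope form_scope.

(** Induction on derivations: valid formulas include the axioms and are closed under both rules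
    ([derivable_valid]). Membership in [sem] commutes with the connectives, so each axiom becomes a
    direct check on the outputs of [xi w u]. Determinism enters only for A4, in
    [Red_axiom_valid]. *)

Section Soundness.
Variables (U : Type) (xi : U -> U -> set U).

Lemma validP A : valid xi A <-> forall v w, sem xi v A w.
Proof.
split=> [vA v w | A_true v]; first by rewrite vA.
by apply/seteqP; split=> w.
Qed.

Lemma sem_Imp v A B w :
  sem xi v (A ==> B) w <-> (sem xi v A w -> sem xi v B w).
Proof.
split=> [[nA /nA //|//] | AB].
by have [/AB|nA] := pselect (sem xi v A w); [right | left].
Qed.

Lemma sem_Neg v A w : sem xi v (Neg A) w <-> ~ sem xi v A w.
Proof. exact: sem_Imp. Qed.

Lemma sem_Or v A B w :
  sem xi v (Or A B) w <-> sem xi v A w \/ sem xi v B w.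
Proof.
rewrite sem_Imp sem_Neg; split=> [nAB | [] //].
by have [|/nAB] := pselect (sem xi v A w); [left | right].
Qed.

Lemma sem_And v A B w :
  sem xi v (And A B) w <-> sem xi v A w /\ sem xi v B w.
Proof.
rewrite sem_Neg sem_Imp sem_Neg.
by split=> [/not_implyP[wA /contrapT] | [wA wB] /(_ wA)].
Qed.

(** Stated for any [Ax] so as to serve both logics. Rule M is sound because a valid implication is
    an inclusion of denotations, and [|>] is antitone on the left, monotone on the right. *)
Lemma derivable_valid (Ax : form -> Prop) A :
  (forall B, Ax B -> valid xi B) -> derivable Ax A -> valid xi A.
Proof.
move=> Ax_valid; elim=> {A} [A /Ax_valid // | A B _ /validP vAB _ /validP vA |].
  by apply/validP=> v w; apply: (sem_Imp v A B w).1.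
move=> A1 A2 B1 B2 _ /validP vA _ /validP vB.
apply/validP=> v w; apply/sem_Imp=> wAB u uA1 xiu.
(* The premises of M are used away from [w]: one at the input [u], the other at the output [y]. *)
have /wAB/(_ xiu)[y [xiy yB1]] := (sem_Imp v A1 A2 u).1 (vA v u) uA1.
by exists y; split=> //; apply: (sem_Imp v B1 B2 y).1.
Qed.

Lemma CPL_axiom_valid A : CPL_axiom A -> valid xi A.
Proof.
move=> axA; apply/validP=> v w; case: axA => {A} [A B | A B C | A].
- by rewrite !sem_Imp.
- by rewrite !sem_Imp => ABC AB wA; apply: ABC => //; apply: AB.
- by rewrite sem_Imp !sem_Neg => /contrapT.
Qed.

Lemma Re_axiom_valid A : Re_axiom A -> valid xi A.
Proof.
case=> {A} [A /CPL_axiom_valid // | A B C | A | A]; apply/validP=> v w.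
- rewrite !sem_Imp => wAB wCB u.
  by move=> /sem_Or[]; [apply: wAB | apply: wCB].
- by [].
(* A3: any output lies in the denotation of [Top]. *)
- by move=> u _ [y xiy]; exists y; split=> //; apply/sem_Neg.
Qed.

(** For A4, the premises give outputs [y] in [B] and [z] in [C] on the same input; being
    single-valued forces [y = z], a common witness for [And B C]. *)
Lemma Red_axiom_valid A :
  (forall w x, is_subset1 (xi w x)) -> Red_axiom A -> valid xi A.
Proof.
move=> xi_det; case=> {A} [A /Re_axiom_valid // | A B C].
apply/validP=> v w; rewrite !sem_Imp => wAB wAC u uA xiu.
have [y [xiy yB]] := wAB u uA xiu; have [z [xiz zC]] := wAC u uA xiu.
exists y; split=> //; apply/sem_And; split=> //.
by rewrite (xi_det w u y z).
Qed.

End Soundness.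

Theorem theorem2 (U : countType) (phi : form) :
  (Re_provable phi ->
     forall xi : U -> U -> set U,
       (forall w : U, nd_partial_recursive (xi w)) -> valid xi phi) /\
  (Red_provable phi ->
     forall xi : U -> U -> set U,
       (forall w : U, partial_recursive (xi w)) -> valid xi phi).
Proof.
split=> phi_provable xi xi_rec; apply: derivable_valid phi_provable => A.
  exact: Re_axiom_valid.
by apply: Red_axiom_valid => w; case: (xi_rec w).
Qed.
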